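(* Work in the field $K$ with the automorphisms $s_0,s_1,s_2,\pi_1,\pi_2$ defined in the context. (i) Let $\Xi$ be the transformation of $K$ defined by $$(\nu_1,\nu_2,\nu_3,\nu_4,\nu_5,\nu_6,\nu_7,\nu_8;\kappa_1,\kappa_2;f,g)\mapsto\Bigl(\frac{\nu_1\nu_5\nu_6}{\kappa_2},\frac{\nu_2\nu_5\nu_6}{\kappa_2},\frac{\kappa_1}{q\nu_4},\frac{\kappa_1}{q\nu_3},\frac{\nu_5\nu_1\nu_2}{\kappa_2},\frac{\nu_6\nu_1\nu_2}{\kappa_2},\frac{\kappa_1}{q\nu_8},\frac{\kappa_1}{q\nu_7};\frac{\kappa_1^3}{q^2\nu_3\nu_4\nu_7\nu_8},\frac{\nu_1\nu_2\nu_5\nu_6}{\kappa_2};\frac{f\kappa_1}{q\nu_3\nu_4},\frac{g\kappa_2}{\nu_5\nu_6}\Bigr),$$ and set $T=\Xi\cdot(\pi_2\pi_1s_2s_1s_0s_2)^2$. Then $$T(f)=\frac{\nu_3\nu_4}{f}\,\frac{(g-\nu_5/\kappa_2)(g-\nu_6/\kappa_2)}{(g-1/\nu_1)(g-1/\nu_2)},$$ $$T(g)=\frac{1}{g\,\nu_1\nu_2}\,\frac{(T(f)-T(\kappa_1/\nu_7))(T(f)-T(\kappa_1/\nu_8))}{(T(f)-\nu_3)(T(f)-\nu_4)},$$ and $$T(\nu_i)=\nu_i\ (i=1,\dots,8),\qquad T(\kappa_1)=\kappa_1/q,\qquad T(\kappa_2)=q\kappa_2 .$$ That is, $T$ represents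 the time evolution of the $q$-Painlevé equation $q$-$P(D_5^{(1)})$. (ii) For any element $\zeta$ generated by (i.e. any rational function of) $\nu_1,\nu_2,\nu_3,\nu_4,\nu_5/\kappa_2,\nu_6/\kappa_2,\nu_7/\kappa_1,\nu_8/\kappa_1,f,g$, we have $$\Xi(\zeta)=G\Bigl[\frac{\kappa_2}{\nu_5\nu_6}\Bigr]D\Bigl[\frac{\kappa_1}{q\nu_3\nu_4}\Bigr](\zeta),$$ where $G[s]$ and $D[c]$ are the substitutions defined in the context.
   Context: **Field and parameters.** The quantities $q,\kappa_1,\kappa_2,\nu_1,\dots,\nu_8,f,g$ are generic subject to the single relation $\kappa_1^2\kappa_2^2=q\,\nu_1\nu_2\cdots\nu_8$. Equivalently, $K=\mathbb{C}(\kappa_1,\kappa_2,\nu_1,\dots,\nu_8,f,g)$ is the field of rational functions in 12 independent variables, and $q:=\kappa_1^2\kappa_2^2/(\nu_1\cdots\nu_8)$. All transformations are $\mathbb{C}$-algebra homomorphisms of $K$, given by their values on the generators. Generators not mentioned are fixed. Products are compositions of maps, with the rightmost factor applied first: $(ab)(x)=a(b(x))$. **Automorphisms (Weyl group symmetry of type $D_5^{(1)}$).** - $s_0:\ \nu_7\leftrightarrow\nu_8$. - $s_1:\ \nu_3\leftrightarrow\nu_4$. - $s_2:\ \nu_3\to\kappa_1/\nu_7,\ \nu_7\to\kappa_1/\nu_3,\ \kappa_2\to\kappa_1\kappa_2/(\nu_3\nu_7),\ g\to g\,\dfrac{f-\nu_3}{f-\kappa_1/\nu_7}$. - $\pi_1:\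 \nu_1\to1/\nu_1,\ \nu_2\to1/\nu_2,\ \nu_3\to1/\nu_7,\ \nu_4\to1/\nu_8,\ \nu_5\to1/\nu_5,\ \nu_6\to1/\nu_6,\ \nu_7\to1/\nu_3,\ \nu_8\to1/\nu_4,\ \kappa_1\to1/\kappa_1,\ \kappa_2\to1/\kappa_2,\ f\to f/\kappa_1,\ g\to1/g$ (so $q\to1/q$). - $\pi_2:\ \nu_1\to1/\nu_7,\ \nu_2\to1/\nu_8,\ \nu_3\to1/\nu_5,\ \nu_4\to1/\nu_6,\ \nu_5\to1/\nu_3,\ \nu_6\to1/\nu_4,\ \nu_7\to1/\nu_1,\ \nu_8\to1/\nu_2,\ \kappa_1\to1/\kappa_2,\ \kappa_2\to1/\kappa_1,\ f\to1/(\kappa_2g),\ g\to\kappa_1/f$ (so $q\to1/q$). **The equation $q$-$P(D_5^{(1)})$.** It is $$f\overline f=\nu_3\nu_4\frac{(g-\nu_5/\kappa_2)(g-\nu_6/\kappa_2)}{(g-1/\nu_1)(g-1/\nu_2)},\qquad g\underline g=\frac1{\nu_1\nu_2}\frac{(f-\kappa_1/\nu_7)(f-\kappa_1/\nu_8)}{(f-\nu_3)(f-\nu_4)},$$ where the overline is the time evolution and the underline is its inverse, and the parameters evolve by $\overline{\kappa}_1=\kappa_1/q$, $\overline{\kappa}_2=q\kappa_2$, $\overline{\nu}_i=\nu_i$. **The substitutions $G[s]$ and $D[c]$.** For nonzero $s$ and $c$, these act on the ten quantities $(\nu_1,\nu_2,\nu_3,\nu_4,\nu_5/\kappa_2,\nu_6/\kappa_2,\nu_7/\kappa_1,\nu_8/\kappa_1,f,g)$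 (and by substitution on rational functions of them) as follows: - $G[s]$ sends them to $(\nu_1/s,\nu_2/s,\nu_3,\nu_4,s\nu_5/\kappa_2,s\nu_6/\kappa_2,\nu_7/\kappa_1,\nu_8/\kappa_1,f,sg)$. - $D[c]$ sends them to $(\nu_1,\nu_2,c\nu_3,c\nu_4,\nu_5/\kappa_2,\nu_6/\kappa_2,c^{-1}\nu_7/\kappa_1,c^{-1}\nu_8/\kappa_1,cf,g)$. In the composition $G[s]D[c]$ with $s,c\in K$, the bracketed quantities $s,c$ are treated as scalars. So $G[s]D[c]$ is the substitution sending the ten quantities to $(\nu_1/s,\nu_2/s,c\nu_3,c\nu_4,s\nu_5/\kappa_2,s\nu_6/\kappa_2,c^{-1}\nu_7/\kappa_1,c^{-1}\nu_8/\kappa_1,cf,sg)$. *)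

(* Defs.v *)
From HB Require Import structures.
From mathcomp Require Import all_boot all_order all_algebra.
From mathcomp Require Import generic_quotient fraction reals complex.
From mathcomp Require Import mpoly.

Set Implicit Arguments.
Unset Strict Implicit.
Unset Printing Implicit Defensive.

Import GRing.Theory.
Local Open Scope ring_scope.

(* C(X_0, ..., X_(n-1)), where R[i] is the field of complex numbers. *)
Definition ratfun (R : realType) (n : nat) : fieldType :=
  {fraction {mpoly R[i][n]}}.

(* The variables are taken in the order
   nu_1, ..., nu_8, kappa_1, kappa_2, f, g. *)
Definition K (R : realType) : fieldType := ratfun R 12.

Section Field.
Context {R : realType}.
Local Notation K := (K R).

Definition cst (c : R[i]) : K := tofrac (mpolyC 12 c).
Definition gen (i : 'I_12) : K := tofrac (mpolyX R[i] U_(i)%MM).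

Definition nu1 : K := gen (@Ordinal 12 0 isT).
Definition nu2 : K := gen (@Ordinal 12 1 isT).
Definition nu3 : K := gen (@Ordinal 12 2 isT).
Definition nu4 : K := gen (@Ordinal 12 3 isT).
Definition nu5 : K := gen (@Ordinal 12 4 isT).
Definition nu6 : K := gen (@Ordinal 12 5 isT).
Definition nu7 : K := gen (@Ordinal 12 6 isT).
Definition nu8 : K := gen (@Ordinal 12 7 isT).
Definition kappa1 : K := gen (@Ordinal 12 8 isT).
Definition kappa2 : K := gen (@Ordinal 12 9 isT).
Definition f : K := gen (@Ordinal 12 10 isT).
Definition g : K := gen (@Ordinal 12 11 isT).

Definition q : K :=
  kappa1 ^+ 2 * kappa2 ^+ 2
  / (nu1 * nu2 * nu3 * nu4 * nu5 * nu6 * nu7 * nu8).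

(* [subst w Z] is Z(w_0, ..., w_(n-1)), computed by evaluating the numerator and
   the denominator of a representative of Z.  When the w_i are algebraically
   independent over C the choice of the representative does not matter and
   [subst w] is the C-algebra homomorphism X_i |-> w_i; this is the case for
   every tuple it is applied to below. *)
Definition subst (n : nat) (w : n.-tuple K) (Z : ratfun R n) : K :=
  mmap cst (tnth w) (\n_(repr Z)) / mmap cst (tnth w) (\d_(repr Z)).

Definition s0 : K -> K := subst
  [tuple nu1; nu2; nu3; nu4; nu5; nu6; nu8; nu7; kappa1; kappa2; f; g].

Definition s1 : K -> K := subst
  [tuple nu1; nu2; nu4; nu3; nu5; nu6; nu7; nu8; kappa1; kappa2; f; g].

Definition s2 : K -> K := subst
  [tuple nu1; nu2; kappa1 / nu7; nu4; nu5; nu6; kappa1 / nu3; nu8;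
         kappa1; kappa1 * kappa2 / (nu3 * nu7);
         f; g * ((f - nu3) / (f - kappa1 / nu7))].

Definition pi1 : K -> K := subst
  [tuple 1 / nu1; 1 / nu2; 1 / nu7; 1 / nu8; 1 / nu5; 1 / nu6; 1 / nu3; 1 / nu4;
         1 / kappa1; 1 / kappa2;
         f / kappa1; 1 / g].

Definition pi2 : K -> K := subst
  [tuple 1 / nu7; 1 / nu8; 1 / nu5; 1 / nu6; 1 / nu3; 1 / nu4; 1 / nu1; 1 / nu2;
         1 / kappa2; 1 / kappa1;
         1 / (kappa2 * g); kappa1 / f].

Definition Xi : K -> K := subst
  [tuple nu1 * nu5 * nu6 / kappa2; nu2 * nu5 * nu6 / kappa2;
         kappa1 / (q * nu4); kappa1 / (q * nu3);
         nu5 * nu1 * nu2 / kappa2; nu6 * nu1 * nu2 / kappa2;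
         kappa1 / (q * nu8); kappa1 / (q * nu7);
         kappa1 ^+ 3 / (q ^+ 2 * nu3 * nu4 * nu7 * nu8);
         nu1 * nu2 * nu5 * nu6 / kappa2;
         f * kappa1 / (q * nu3 * nu4); g * kappa2 / (nu5 * nu6)].

Definition alg_hom (T : K -> K) : Prop :=
  [/\ zmod_morphism T, monoid_morphism T & forall c, T (cst c) = cst c].

(* x |-> T x is the overline (time evolution) and its inverse U is the
   underline. *)
Definition qPD5_time_evolution (T : K -> K) : Prop :=
  alg_hom T /\
  exists U : K -> K,
    (cancel T U /\ cancel U T) /\
    f * T f = nu3 * nu4 * (((g - nu5 / kappa2) * (g - nu6 / kappa2))
                           / ((g - 1 / nu1) * (g - 1 / nu2))) /\
    g * U g = 1 / (nu1 * nu2) * (((f - kappa1 / nu7) * (f - kappa1 / nu8))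
                                 / ((f - nu3) * (f - nu4))) /\
    (T kappa1 = kappa1 / q /\ T kappa2 = q * kappa2) /\
    ([/\ T nu1 = nu1, T nu2 = nu2, T nu3 = nu3 & T nu4 = nu4] /\
     [/\ T nu5 = nu5, T nu6 = nu6, T nu7 = nu7 & T nu8 = nu8]).

Definition ten : 10.-tuple K :=
  [tuple nu1; nu2; nu3; nu4; nu5 / kappa2; nu6 / kappa2;
         nu7 / kappa1; nu8 / kappa1; f; g].

(* G[s] and D[c] act on the values of the ten quantities, s and c being mere
   scalars: G[s]D[c] maps Z(ten) to Z(G[s]D[c] ten), for Z in C(X_0,...,X_9). *)
Definition G (s : K) (t : 10.-tuple K) : 10.-tuple K :=
  let x (i : nat) := nth 0 t i in
  [tuple x 0%N / s; x 1%N / s; x 2%N; x 3%N; s * x 4%N; s * x 5%N;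
         x 6%N; x 7%N; x 8%N; s * x 9%N].

Definition D (c : K) (t : 10.-tuple K) : 10.-tuple K :=
  let x (i : nat) := nth 0 t i in
  [tuple x 0%N; x 1%N; c * x 2%N; c * x 3%N; x 4%N; x 5%N;
         c^-1 * x 6%N; c^-1 * x 7%N; c * x 8%N; x 9%N].

End Field.

(* Main.v *)
Require Import Defs.
From HB Require Import structures.
From mathcomp Require Import all_boot all_order all_algebra.
From mathcomp Require Import generic_quotient fraction reals complex.
From mathcomp Require Import mpoly ring.

Set Implicit Arguments.
Unset Strict Implicit.
Unset Printing Implicit Defensive.

Import GRing.Theory.
Local Open Scope ring_scope.

(** A substitution X_i |-> w_i of C(X_1, ..., X_n) is a field homomorphism as
    soon as the w_i are algebraically independent.  This holds if all w_i are
    regular at some point v with w_i(v) = X_i: a relation p(w) = 0 specializes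
    to p(X) = 0.  The generators s_0, s_1, s_2, pi_1, pi_2 are involutions, so
    each is its own point v, and Xi is inverted by an explicit map of the same
    shape.  Hence T is an automorphism; its values on the generators are computed
    in two halves through w = pi_2 pi_1 s_2 s_1 s_0 s_2. *)

(** * Values of fractions at a point, and extension of morphisms to a fraction field *)

Lemma tofrac_numden (P : idomainType) (Z : {fraction P}) :
  tofrac \n_(repr Z) / tofrac \d_(repr Z) = Z.
Proof.
rewrite -[RHS]reprK; move: (repr Z) => z.
have dz : tofrac \d_z != 0 by rewrite tofrac_eq0 denom_ratioP.
(* Once the denominator is cleared, both sides are classes of explicit pairs, which are compared by
   cross-multiplication. *)
apply: (mulIf dz); rewrite divfK //; unlock FracField.tofrac.
rewrite -[RHS]FracField.pi_mul; apply/eqmodP.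
rewrite /= FracField.equivfE /FracField.mulf.
rewrite !numden_Ratio ?mulr1 ?oner_eq0 ?denom_ratioP //.
by rewrite mul1r.
Qed.

Section Specialization.
Variables (P : idomainType) (F : fieldType) (ev : {rmorphism P -> F}).
Implicit Types (Z : {fraction P}) (y : F).

(* Z is regular at the point ev of Spec P, with value y. *)
Definition specializes Z y : Prop :=
  exists a b, [/\ ev b != 0, Z = tofrac a / tofrac b & y = ev a / ev b].

Lemma specializes_tofrac p : specializes (tofrac p) (ev p).
Proof. by exists p, 1; rewrite !rmorph1 !divr1 oner_eq0. Qed.

Lemma tofrac_neq0 b : ev b != 0 -> tofrac b != 0.
Proof. by rewrite tofrac_eq0; apply: contra_neq => ->; rewrite rmorph0. Qed.

Lemma specializesM Z Z' y y' :
  specializes Z y -> specializes Z' y' -> specializes (Z * Z') (y * y').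
Proof.
move=> [a [b [b0 -> ->]]] [c [d [d0 -> ->]]]; exists (a * c), (b * d).
by rewrite !rmorphM mulf_neq0 // !mulf_div.
Qed.

Lemma specializesD Z Z' y y' :
  specializes Z y -> specializes Z' y' -> specializes (Z + Z') (y + y').
Proof.
move=> [a [b [b0 -> ->]]] [c [d [d0 -> ->]]].
have [tb td] := (tofrac_neq0 b0, tofrac_neq0 d0).
exists (a * d + c * b), (b * d).
by rewrite !rmorphD !rmorphM mulf_neq0 // !addf_div.
Qed.

Lemma specializesN Z y : specializes Z y -> specializes (- Z) (- y).
Proof.
by move=> [a [b [b0 -> ->]]]; exists (- a), b; rewrite !rmorphN !mulNr.
Qed.

Lemma specializes0 : specializes 0 0.
Proof. by have := specializes_tofrac 0; rewrite !rmorph0. Qed.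

Lemma specializes1 : specializes 1 1.
Proof. by have := specializes_tofrac 1; rewrite !rmorph1. Qed.

Lemma specializesX Z y k : specializes Z y -> specializes (Z ^+ k) (y ^+ k).
Proof.
move=> sZ; elim: k => [|k IHk]; first by rewrite !expr0; apply: specializes1.
by rewrite !exprS; apply: specializesM.
Qed.

Lemma specializesV Z y : specializes Z y -> y != 0 -> specializes Z^-1 y^-1.
Proof.
move=> [a [b [b0 -> ->]]]; rewrite mulf_eq0 invr_eq0 (negbTE b0) orbF => a0.
by exists b, a; rewrite !invf_div.
Qed.

(** Two representations of [Z] satisfy a cross-multiplied identity in [P], which [ev] carries over
    to the values. Several equalities below are proved by exhibiting both sides as values of one
    fraction. *)
Lemma specializes_uniq Z y y' : specializes Z y -> specializes Z y' -> y = y'.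
Proof.
move=> [a [b [b0 -> ->]]] [c [d [d0 /eqP + ->]]].
have [tb td] := (tofrac_neq0 b0, tofrac_neq0 d0).
rewrite eqr_div // -!tofracM tofrac_eq => /eqP e.
by apply/eqP; rewrite eqr_div // -!rmorphM e.
Qed.

Hypothesis ev_inj : forall p, ev p = 0 -> p = 0.

(** This has the shape of [subst], with [ev] the evaluation of polynomials at a tuple, so what is
    proved of [ext] transfers to [subst] by conversion. *)
Definition ext Z : F := ev \n_(repr Z) / ev \d_(repr Z).

Lemma specializes_ext Z : specializes Z (ext Z).
Proof.
exists \n_(repr Z), \d_(repr Z); rewrite tofrac_numden; split=> //.
by apply/eqP => /ev_inj /eqP; apply/negP; apply: denom_ratioP.
Qed.

Lemma ext_tofrac p : ext (tofrac p) = ev p.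
Proof. exact: specializes_uniq (specializes_ext _) (specializes_tofrac p). Qed.

(** The difference of the values of [Z] and [Z'] is a value of [Z - Z'], and values are unique. *)
Lemma ext_is_zmod_morphism : zmod_morphism ext.
Proof.
move=> Z Z'; apply: specializes_uniq (specializes_ext _) _.
exact: specializesD (specializes_ext _) (specializesN (specializes_ext _)).
Qed.

Lemma ext_is_monoid_morphism : monoid_morphism ext.
Proof.
split=> [|Z Z']; first by rewrite -tofrac1 ext_tofrac rmorph1.
apply: specializes_uniq (specializes_ext _) _.
exact: specializesM (specializes_ext _) (specializes_ext _).
Qed.
End Specialization.

(** * Polynomial evaluation and algebraic independence *)

Definition fracC (C : idomainType) n (c : C) : {fraction {mpoly C[n]}} :=
  tofrac c%:MP.

Lemma fracC_is_zmod_morphism (C : idomainType) n : zmod_morphism (@fracC C n).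
Proof. by move=> x y; rewrite /fracC mpolyCB tofracB. Qed.

Lemma fracC_is_monoid_morphism (C : idomainType) n :
  monoid_morphism (@fracC C n).
Proof.
by split=> [|x y]; rewrite /fracC ?mpolyCM ?tofracM // mpolyC1 tofrac1.
Qed.

HB.instance Definition _ (C : idomainType) n :=
  GRing.isZmodMorphism.Build C {fraction {mpoly C[n]}} (@fracC C n)
    (@fracC_is_zmod_morphism C n).
HB.instance Definition _ (C : idomainType) n :=
  GRing.isMonoidMorphism.Build C {fraction {mpoly C[n]}} (@fracC C n)
    (@fracC_is_monoid_morphism C n).

Section Polynomials.
Variables (C : idomainType) (n : nat).
Local Notation P := {mpoly C[n]}.
Local Notation var i := (tofrac (mpolyX C U_(i)%MM) : {fraction P}).

(** The embedding of polynomials into fractions is evaluation at the variables. This yields the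
    independence of the generators and lets a morphism be determined by its values on them. *)
Lemma tofrac_mmap (p : P) :
  tofrac p = mmap (@fracC C n) (fun i => var i) p.
Proof.
rewrite {1}[p]mpolyE rmorph_sum; apply: eq_bigr => m _.
rewrite -mul_mpolyC rmorphM mpolyXE_id rmorph_prod; congr (_ * _).
by apply: eq_bigr => i _; rewrite rmorphXn.
Qed.

Variables (F : fieldType) (h : {rmorphism C -> F}).

(** Evaluating a polynomial involves only constants, sums and products, all of which preserve
    regularity at [v]. *)
Lemma specializes_mmap (v : 'I_n -> F) k (w : 'I_k -> {fraction P})
    (u : 'I_k -> F) (p : {mpoly C[k]}) :
  (forall i, specializes (mmap h v) (w i) (u i)) ->
  specializes (mmap h v) (mmap (@fracC C n) w p) (mmap h u p).
Proof.
move=> wu; rewrite /mmap.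
apply: (big_ind2 (specializes (mmap h v))) => [||m _].
- exact: specializes0.
- by move=> *; apply: specializesD.
apply: specializesM.
  by have := specializes_tofrac (mmap h v) (p@_m)%:MP; rewrite /= mmapC.
apply: (big_ind2 (specializes (mmap h v))) => [||i _].
- exact: specializes1.
- by move=> *; apply: specializesM.
exact: specializesX.
Qed.
End Polynomials.

Lemma rmorph_mmap (C F F' : comNzRingType) (h : C -> F) (h' : C -> F')
    (T : {rmorphism F -> F'}) n (w : 'I_n -> F) (p : {mpoly C[n]}) :
  (forall c, T (h c) = h' c) -> T (mmap h w p) = mmap h' (T \o w) p.
Proof.
move=> Tc; rewrite /mmap rmorph_sum; apply: eq_bigr => m _.
rewrite rmorphM Tc /mmap1 rmorph_prod; congr (_ * _).
by apply: eq_bigr => i _; rewrite rmorphXn.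
Qed.

(** A relation p(w) = 0 specializes at [v] to p(u) = 0, because 0 is the only value of the zero
    fraction; independence thus passes from [u] to [w]. *)
Lemma mmap_indep (C : idomainType) n (F : fieldType) (h : {rmorphism C -> F})
    (v u : 'I_n -> F) (w : 'I_n -> {fraction {mpoly C[n]}}) :
  (forall p, mmap h u p = 0 -> p = 0) ->
  (forall i, specializes (mmap h v) (w i) (u i)) ->
  forall p, mmap (@fracC C n) w p = 0 -> p = 0.
Proof.
move=> u_indep wu p wp0; apply: u_indep.
have := specializes_mmap p wu; rewrite wp0 => /specializes_uniq; apply.
exact: specializes0.
Qed.

Lemma rmorph_fraction_eq (C F : idomainType) n
    (T T' : {rmorphism {fraction {mpoly C[n]}} -> F}) :
  (forall c, T (fracC n c) = T' (fracC n c)) ->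
  (forall i, T (tofrac 'X_i) = T' (tofrac 'X_i)) -> T =1 T'.
Proof.
move=> Tc TX Z.
have e p : T (tofrac p) = T' (tofrac p).
  rewrite tofrac_mmap !(rmorph_mmap _ _ (fun c => erefl)).
  apply: eq_bigr => m _; rewrite /= Tc /mmap1; congr (_ * _).
  by apply: eq_bigr => i _; rewrite /= TX.
rewrite -[Z]tofrac_numden.
set a := tofrac \n_ _; set b := tofrac \d_ _.
have b0 : b != 0 by rewrite tofrac_eq0 denom_ratioP.
(* The target is only an integral domain, so [T b] is cancelled as the image of a unit. *)
have u : T b \is a GRing.unit by rewrite rmorph_unit // unitfE.
by apply: (mulIr u); rewrite -rmorphM divfK // e e -rmorphM divfK.
Qed.

Lemma mmap_gen_inj (R : realType) p : mmap (@cst R) (@gen R) p = 0 -> p = 0.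
Proof. by move=> e; apply/eqP; rewrite -tofrac_eq0 tofrac_mmap; apply/eqP. Qed.

(** * Substitutions as algebra homomorphisms of [K] *)

Section AlgebraHomomorphisms.
Variable R : realType.
Local Notation K := (K R).

(** [cst] unfolds to [fracC] over the complex numbers and inherits its ring morphism structure. *)
HB.instance Definition _ := GRing.RMorphism.copy (@cst R) (@fracC R[i] 12).

Section Subst.
Variables w v : 12.-tuple K.
Local Notation ev u := (mmap (@cst R) (tnth u)).
Hypothesis wv : forall i, specializes (ev v) (tnth w i) (gen i).

Let w_indep p : ev w p = 0 -> p = 0.
Proof. exact: (mmap_indep (@mmap_gen_inj R) wv). Qed.

Lemma subst_alg_hom : alg_hom (subst w).
Proof.
split.
- exact: (ext_is_zmod_morphism w_indep).
- exact: (ext_is_monoid_morphism w_indep).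
by move=> c; rewrite [LHS](ext_tofrac w_indep); apply: mmapC.
Qed.

Lemma subst_gen i : subst w (gen i) = tnth w i.
Proof.
apply: etrans (ext_tofrac w_indep _) _.
exact: etrans (mmapX _ _ _) (mmap1U _ _).
Qed.

Lemma specializes_subst Z : specializes (ev w) Z (subst w Z).
Proof. exact: (specializes_ext w_indep Z). Qed.
End Subst.

Lemma specializes_gen (v : 12.-tuple K) i :
  specializes (mmap (@cst R) (tnth v)) (gen i) (tnth v i).
Proof.
rewrite -[tnth v i](etrans (mmapX _ (@cst R) _) (mmap1U _ _)).
exact: specializes_tofrac.
Qed.

(** The ordinals carry the bound proof [isT], so that each case matches the definition of one of
    [nu1], ..., [g] syntactically. *)
Lemma ord12P (P : 'I_12 -> Prop) :
  P (@Ordinal 12 0 isT) -> P (@Ordinal 12 1 isT) -> P (@Ordinal 12 2 isT) ->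
  P (@Ordinal 12 3 isT) -> P (@Ordinal 12 4 isT) -> P (@Ordinal 12 5 isT) ->
  P (@Ordinal 12 6 isT) -> P (@Ordinal 12 7 isT) -> P (@Ordinal 12 8 isT) ->
  P (@Ordinal 12 9 isT) -> P (@Ordinal 12 10 isT) -> P (@Ordinal 12 11 isT) ->
  forall i, P i.
Proof.
move=> P0 P1 P2 P3 P4 P5 P6 P7 P8 P9 P10 P11 [m lt_m].
by do 12!(case: m lt_m => [|m] lt_m;
  first by rewrite (bool_irrelevance lt_m isT)).
Qed.

Lemma gen_neq0 i : gen i != 0 :> K.
Proof. by rewrite tofrac_eq0 -msupp_eq0 msuppX. Qed.

(** The value [y'] may stay an existential variable, filled in while the expression [Z] is
    traversed; [y' = y] is then a separate field computation. *)
Lemma specializes_eq (v : 12.-tuple K) Z y y' :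
  specializes (mmap (@cst R) (tnth v)) Z y' -> y' = y ->
  specializes (mmap (@cst R) (tnth v)) Z y.
Proof. by move=> ? <-. Qed.

Lemma gen_eq i j : (gen i == gen j :> K) = (i == j).
Proof.
rewrite tofrac_eq; apply/eqP/eqP => [e|-> //].
have := congr1 (fun p : {mpoly R[i][12]} => p@_U_(j)) e.
rewrite !mcoeffXU eqxx; case: eqP => // _ /eqP.
by rewrite eq_sym oner_eq0.
Qed.

(** The two monomials have degrees 2 and 1. Such differences arise when denominators like
    [f - kappa1 / nu7] are cleared. *)
Lemma genM_neq i j k : gen i * gen j != gen k :> K.
Proof.
rewrite -tofracM tofrac_eq -mpolyXD; apply/eqP => e.
have := congr1 (fun p : {mpoly R[i][12]} => p@_U_(k)) e.
rewrite !mcoeffX eqxx; case: eqP => [e'|_ /eqP]; last first.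
  by rewrite eq_sym oner_eq0.
by have := congr1 mdeg e'; rewrite mdegD !mdeg1.
Qed.

Lemma genM_neq1 i j : gen i * gen j != 1 :> K.
Proof.
rewrite -tofracM -tofrac1 tofrac_eq -mpolyXD -mpolyX0; apply/eqP => e.
have := congr1 (fun p : {mpoly R[i][12]} => p@_(U_(i) + U_(j))) e.
rewrite !mcoeffX eqxx; case: eqP => [e'|_ /eqP]; last by rewrite oner_eq0.
by have := congr1 mdeg e'; rewrite mdegD !mdeg1 mdeg0.
Qed.

Lemma alg_hom_comp (T T' : K -> K) :
  alg_hom T -> alg_hom T' -> alg_hom (T \o T').
Proof.
move=> [Tz [T1 TM] Tc] [Tz' [T1' TM'] Tc']; split=> [x y||c] /=.
- by rewrite Tz' Tz.
- by split=> [|x y] /=; rewrite ?T1' // TM' TM.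
- by rewrite Tc' Tc.
Qed.

Definition alg_hom_rmorph (T : K -> K) (hT : alg_hom T) : {rmorphism K -> K} :=
  HB.pack T
    (GRing.isZmodMorphism.Build K K T (let: And3 Tz _ _ := hT in Tz))
    (GRing.isMonoidMorphism.Build K K T (let: And3 _ Tm _ := hT in Tm)).

Section AlgHomTheory.
Variables (T : K -> K) (hT : alg_hom T).

Lemma alg_homM : {morph T : x y / x * y}.
Proof. exact: (rmorphM (alg_hom_rmorph hT)). Qed.

Lemma alg_homV : {morph T : x / x^-1}.
Proof. exact: (fmorphV (alg_hom_rmorph hT)). Qed.

Lemma alg_homB : {morph T : x y / x - y}.
Proof. exact: (rmorphB (alg_hom_rmorph hT)). Qed.

Lemma alg_hom1 : T 1 = 1.
Proof. exact: (rmorph1 (alg_hom_rmorph hT)). Qed.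

Lemma alg_hom_neq0 x : x != 0 -> T x != 0.
Proof. by move=> x0; rewrite [T x == 0](fmorph_eq0 (alg_hom_rmorph hT) x). Qed.

Definition alg_homE := (alg_homM, alg_homV, alg_homB, alg_hom1).
End AlgHomTheory.

Lemma alg_hom_eq (T T' : K -> K) : alg_hom T -> alg_hom T' ->
  (forall i, T (gen i) = T' (gen i)) -> T =1 T'.
Proof.
move=> hT hT' TX.
apply: (@rmorph_fraction_eq R[i] K 12 (alg_hom_rmorph hT) (alg_hom_rmorph hT')).
  have [[_ _ Tc] [_ _ Tc']] := (hT, hT') => c.
  exact: etrans (Tc c) (esym (Tc' c)).
exact: TX.
Qed.

(** The composite is a homomorphism, so only generators matter; there the composite and the identity
    both give the value of [tnth w i] at [v]. *)
Lemma subst_cancel (w v : 12.-tuple K) :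
  (forall i, specializes (mmap (@cst R) (tnth v)) (tnth w i) (gen i)) ->
  (forall i, specializes (mmap (@cst R) (tnth w)) (tnth v i) (gen i)) ->
  cancel (subst w) (subst v).
Proof.
move=> wv vw; apply: (@alg_hom_eq (subst v \o subst w) id).
- exact: alg_hom_comp (subst_alg_hom vw) (subst_alg_hom wv).
- by split=> //; split.
move=> i /=; rewrite (subst_gen wv); apply: specializes_uniq (wv i).
exact: specializes_subst vw _.
Qed.
End AlgebraHomomorphisms.

(** * Automation for values of explicit expressions and for field identities in the generators *)

Ltac specialize_expr :=
  match goal with
  | |- specializes _ (_ * _) _ =>
      eapply specializesM; [specialize_expr | specialize_expr]
  | |- specializes _ (_ + _) _ =>
      eapply specializesD; [specialize_expr | specialize_expr]
  | |- specializes _ (- _) _ => eapply specializesN; specialize_expr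
  | |- specializes _ (_ ^+ _) _ => eapply specializesX; specialize_expr
  | |- specializes _ (_^-1) _ => eapply specializesV; [specialize_expr | idtac]
  | |- specializes _ q _ => rewrite /q; specialize_expr
  | |- specializes _ 1 _ => exact: specializes1
  | |- _ => exact: specializes_gen
  end.

(* [field] does not terminate on K, whose operations unfold to quotients of
   polynomials; the generators become variables of an abstract field first. *)
Ltac abstract_gens :=
  rewrite ?/q ?/nu1 ?/nu2 ?/nu3 ?/nu4 ?/nu5 ?/nu6 ?/nu7 ?/nu8 ?/kappa1 ?/kappa2
    ?/f ?/g;
  repeat match goal with |- context [@gen ?R ?i] =>
    generalize (gen_neq0 R i); generalize (@gen R i) end;
  match goal with |- context [K ?R] => generalize (K R) end.

Ltac nonzero :=
  match goal with
  | |- is_true (_ && _) => apply/andP; split; nonzero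
  | |- is_true (_ * _ != 0) => apply: mulf_neq0; nonzero
  | |- is_true (_ ^+ _ != 0) => apply: expf_neq0; nonzero
  | |- is_true (- _ != 0) => rewrite oppr_eq0; nonzero
  | |- is_true (_^-1 != 0) => rewrite invr_eq0; nonzero
  | |- is_true (1 != 0) => exact: oner_neq0
  | |- _ => assumption
  end.

Ltac field_gens := abstract_gens; intros; field; nonzero.

(** * The generators as involutions, and the inverse of [Xi] *)

Section Generators.
Variable R : realType.
Local Notation K := (K R).
Local Notation ev w := (mmap (@cst R) (tnth w)).

Definition s0_tuple : 12.-tuple K :=
  [tuple nu1; nu2; nu3; nu4; nu5; nu6; nu8; nu7; kappa1; kappa2; f; g].

Definition s1_tuple : 12.-tuple K :=
  [tuple nu1; nu2; nu4; nu3; nu5; nu6; nu7; nu8; kappa1; kappa2; f; g].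

Definition s2_tuple : 12.-tuple K :=
  [tuple nu1; nu2; kappa1 / nu7; nu4; nu5; nu6; kappa1 / nu3; nu8;
         kappa1; kappa1 * kappa2 / (nu3 * nu7);
         f; g * ((f - nu3) / (f - kappa1 / nu7))].

Definition pi1_tuple : 12.-tuple K :=
  [tuple 1 / nu1; 1 / nu2; 1 / nu7; 1 / nu8; 1 / nu5; 1 / nu6; 1 / nu3; 1 / nu4;
         1 / kappa1; 1 / kappa2;
         f / kappa1; 1 / g].

Definition pi2_tuple : 12.-tuple K :=
  [tuple 1 / nu7; 1 / nu8; 1 / nu5; 1 / nu6; 1 / nu3; 1 / nu4; 1 / nu1; 1 / nu2;
         1 / kappa2; 1 / kappa1;
         1 / (kappa2 * g); kappa1 / f].

Definition Xi_tuple : 12.-tuple K :=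
  [tuple nu1 * nu5 * nu6 / kappa2; nu2 * nu5 * nu6 / kappa2;
         kappa1 / (q * nu4); kappa1 / (q * nu3);
         nu5 * nu1 * nu2 / kappa2; nu6 * nu1 * nu2 / kappa2;
         kappa1 / (q * nu8); kappa1 / (q * nu7);
         kappa1 ^+ 3 / (q ^+ 2 * nu3 * nu4 * nu7 * nu8);
         nu1 * nu2 * nu5 * nu6 / kappa2;
         f * kappa1 / (q * nu3 * nu4); g * kappa2 / (nu5 * nu6)].

(** [Xi] is monomial and fixes [q], so its inverse comes from solving a monomial system; for
    instance [Xi] sends [kappa2 / nu2] to [nu1]. *)
Definition Xi_inv_tuple : 12.-tuple K :=
  [tuple kappa2 / nu2; kappa2 / nu1;
         q * nu3 * nu7 * nu8 / kappa1; q * nu4 * nu7 * nu8 / kappa1;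
         kappa2 / nu6; kappa2 / nu5;
         q * nu7 * nu3 * nu4 / kappa1; q * nu8 * nu3 * nu4 / kappa1;
         q ^+ 2 * nu3 * nu4 * nu7 * nu8 / kappa1;
         kappa2 ^+ 3 / (nu1 * nu2 * nu5 * nu6);
         f * q * nu7 * nu8 / kappa1; g * nu1 * nu2 / kappa2].

Ltac simpl_tuple :=
  cbn [s0_tuple s1_tuple s2_tuple pi1_tuple pi2_tuple Xi_tuple Xi_inv_tuple
       tnth tval tuple nth nat_of_ord].

Ltac check_inverse :=
  apply: ord12P; (eapply specializes_eq; [simpl_tuple; specialize_expr | ..]);
  simpl_tuple.

Lemma s0_involution i : specializes (ev s0_tuple) (tnth s0_tuple i) (gen i).
Proof. by move: i; check_inverse. Qed.

Lemma s1_involution i : specializes (ev s1_tuple) (tnth s1_tuple i) (gen i).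
Proof. by move: i; check_inverse. Qed.

Lemma pi1_involution i : specializes (ev pi1_tuple) (tnth pi1_tuple i) (gen i).
Proof.
move: i; check_inverse; abstract_gens; intros; solve [nonzero | field; nonzero].
Qed.

Lemma pi2_involution i : specializes (ev pi2_tuple) (tnth pi2_tuple i) (gen i).
Proof.
move: i; check_inverse; abstract_gens; intros; solve [nonzero | field; nonzero].
Qed.

Lemma Xi_inverse i : specializes (ev Xi_inv_tuple) (tnth Xi_tuple i) (gen i).
Proof.
move: i; check_inverse; abstract_gens; intros; solve [nonzero | field; nonzero].
Qed.

Lemma Xi_inv_inverse i :
  specializes (ev Xi_tuple) (tnth Xi_inv_tuple i) (gen i).
Proof.
move: i; check_inverse; abstract_gens; intros; solve [nonzero | field; nonzero].
Qed.

Lemma s2_involution i : specializes (ev s2_tuple) (tnth s2_tuple i) (gen i).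
Proof.
have f3 : f - nu3 != 0 :> K by rewrite subr_eq0 gen_eq.
(* This is [f - kappa1 / nu7] multiplied by [nu7], the cleared form suited to the side conditions of
   [field]. *)
have fk : f * nu7 - kappa1 != 0 :> K by rewrite subr_eq0; apply: genM_neq.
move: i; check_inverse; move: f3 fk; abstract_gens; intros;
  try solve [reflexivity | nonzero | field; nonzero].
(* What remains is that the denominator [f - kappa1 / nu7] does not vanish at the point: its value
   there is [f - kappa1 / (kappa1 / nu3)], that is, [f - nu3]. *)
by rewrite divKf.
Qed.
End Generators.

(** * The half step [w], the evolution [T], and their values on generators *)

Section Evolution.
Variable R : realType.
Local Notation K := (K R).

Lemma s0_alg_hom : alg_hom (@s0 R).
Proof. exact: subst_alg_hom (@s0_involution R). Qed.

Lemma s1_alg_hom : alg_hom (@s1 R).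
Proof. exact: subst_alg_hom (@s1_involution R). Qed.

Lemma s2_alg_hom : alg_hom (@s2 R).
Proof. exact: subst_alg_hom (@s2_involution R). Qed.

Lemma pi1_alg_hom : alg_hom (@pi1 R).
Proof. exact: subst_alg_hom (@pi1_involution R). Qed.

Lemma pi2_alg_hom : alg_hom (@pi2 R).
Proof. exact: subst_alg_hom (@pi2_involution R). Qed.

Lemma Xi_alg_hom : alg_hom (@Xi R).
Proof. exact: subst_alg_hom (@Xi_inverse R). Qed.

Definition w : K -> K := pi2 \o pi1 \o s2 \o s1 \o s0 \o s2.

Lemma w_alg_hom : alg_hom w.
Proof.
do !apply: alg_hom_comp; [exact: pi2_alg_hom|exact: pi1_alg_hom
  |exact: s2_alg_hom|exact: s1_alg_hom|exact: s0_alg_hom|exact: s2_alg_hom].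
Qed.

Lemma s0E :
  ((s0 nu1 = nu1 :> K) * (s0 nu2 = nu2 :> K) * (s0 nu3 = nu3 :> K) *
   (s0 nu4 = nu4 :> K) * (s0 nu5 = nu5 :> K) * (s0 nu6 = nu6 :> K) *
   (s0 nu7 = nu8 :> K) * (s0 nu8 = nu7 :> K) * (s0 kappa1 = kappa1 :> K) *
   (s0 kappa2 = kappa2 :> K) * (s0 f = f :> K) * (s0 g = g :> K))%type.
Proof. by do !split; apply: (subst_gen (@s0_involution R)). Qed.

Lemma s1E :
  ((s1 nu1 = nu1 :> K) * (s1 nu2 = nu2 :> K) * (s1 nu3 = nu4 :> K) *
   (s1 nu4 = nu3 :> K) * (s1 nu5 = nu5 :> K) * (s1 nu6 = nu6 :> K) *
   (s1 nu7 = nu7 :> K) * (s1 nu8 = nu8 :> K) * (s1 kappa1 = kappa1 :> K) *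
   (s1 kappa2 = kappa2 :> K) * (s1 f = f :> K) * (s1 g = g :> K))%type.
Proof. by do !split; apply: (subst_gen (@s1_involution R)). Qed.

Lemma s2E :
  ((s2 nu1 = nu1 :> K) * (s2 nu2 = nu2 :> K) *
   (s2 nu3 = (kappa1 / nu7)%R :> K) * (s2 nu4 = nu4 :> K) *
   (s2 nu5 = nu5 :> K) * (s2 nu6 = nu6 :> K) *
   (s2 nu7 = (kappa1 / nu3)%R :> K) * (s2 nu8 = nu8 :> K) *
   (s2 kappa1 = kappa1 :> K) *
   (s2 kappa2 = (kappa1 * kappa2 / (nu3 * nu7))%R :> K) * (s2 f = f :> K) *
   (s2 g = (g * ((f - nu3) / (f - kappa1 / nu7)))%R :> K))%type.
Proof. by do !split; apply: (subst_gen (@s2_involution R)). Qed.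

Lemma pi1E :
  ((pi1 nu1 = (1 / nu1)%R :> K) * (pi1 nu2 = (1 / nu2)%R :> K) *
   (pi1 nu3 = (1 / nu7)%R :> K) * (pi1 nu4 = (1 / nu8)%R :> K) *
   (pi1 nu5 = (1 / nu5)%R :> K) * (pi1 nu6 = (1 / nu6)%R :> K) *
   (pi1 nu7 = (1 / nu3)%R :> K) * (pi1 nu8 = (1 / nu4)%R :> K) *
   (pi1 kappa1 = (1 / kappa1)%R :> K) * (pi1 kappa2 = (1 / kappa2)%R :> K) *
   (pi1 f = (f / kappa1)%R :> K) * (pi1 g = (1 / g)%R :> K))%type.
Proof. by do !split; apply: (subst_gen (@pi1_involution R)). Qed.

Lemma pi2E :
  ((pi2 nu1 = (1 / nu7)%R :> K) * (pi2 nu2 = (1 / nu8)%R :> K) *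
   (pi2 nu3 = (1 / nu5)%R :> K) * (pi2 nu4 = (1 / nu6)%R :> K) *
   (pi2 nu5 = (1 / nu3)%R :> K) * (pi2 nu6 = (1 / nu4)%R :> K) *
   (pi2 nu7 = (1 / nu1)%R :> K) * (pi2 nu8 = (1 / nu2)%R :> K) *
   (pi2 kappa1 = (1 / kappa2)%R :> K) * (pi2 kappa2 = (1 / kappa1)%R :> K) *
   (pi2 f = (1 / (kappa2 * g))%R :> K) * (pi2 g = (kappa1 / f)%R :> K))%type.
Proof. by do !split; apply: (subst_gen (@pi2_involution R)). Qed.

Lemma XiE :
  ((Xi nu1 = (nu1 * nu5 * nu6 / kappa2)%R :> K) *
   (Xi nu2 = (nu2 * nu5 * nu6 / kappa2)%R :> K) *
   (Xi nu3 = (kappa1 / (q * nu4))%R :> K) *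
   (Xi nu4 = (kappa1 / (q * nu3))%R :> K) *
   (Xi nu5 = (nu5 * nu1 * nu2 / kappa2)%R :> K) *
   (Xi nu6 = (nu6 * nu1 * nu2 / kappa2)%R :> K) *
   (Xi nu7 = (kappa1 / (q * nu8))%R :> K) *
   (Xi nu8 = (kappa1 / (q * nu7))%R :> K) *
   (Xi kappa1 = (kappa1 ^+ 3 / (q ^+ 2 * nu3 * nu4 * nu7 * nu8))%R :> K) *
   (Xi kappa2 = (nu1 * nu2 * nu5 * nu6 / kappa2)%R :> K) *
   (Xi f = (f * kappa1 / (q * nu3 * nu4))%R :> K) *
   (Xi g = (g * kappa2 / (nu5 * nu6))%R :> K))%type.
Proof. by do !split; apply: (subst_gen (@Xi_inverse R)). Qed.

Lemma wE x : w x = pi2 (pi1 (s2 (s1 (s0 (s2 x))))).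
Proof. by []. Qed.

Ltac eval_w :=
  rewrite wE ?s2E ?(alg_homE s0_alg_hom) ?s0E ?(alg_homE s1_alg_hom) ?s1E
    ?(alg_homE s2_alg_hom) ?s2E ?(alg_homE pi1_alg_hom) ?pi1E
    ?(alg_homE pi2_alg_hom) ?pi2E.

(** All generators except [g] have monomial images; the dynamics is concentrated in [w g]. *)
Lemma w_genE :
  ((w nu1 = nu7 :> K) * (w nu2 = nu8 :> K) * (w nu3 = (kappa2 / nu6)%R :> K) *
   (w nu4 = (kappa2 / nu5)%R :> K) * (w nu5 = nu3 :> K) * (w nu6 = nu4 :> K) *
   (w nu7 = (kappa2 / nu2)%R :> K) * (w nu8 = (kappa2 / nu1)%R :> K) *
   (w kappa1 = kappa2 :> K) *
   (w kappa2 = (kappa1 * kappa2 ^+ 2 / (nu1 * nu2 * nu5 * nu6))%R :> K) *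
   (w f = (1 / g)%R :> K))%type.
Proof. by do !split; eval_w; field_gens. Qed.

(** Each of the two occurrences of [s2] in [w] contributes one quotient of differences. *)
Lemma w_g :
  w g = f / kappa1 * ((1 / g - nu1) / (1 / g - kappa2 / nu5))
        * ((1 / g - nu2) / (1 / g - kappa2 / nu6)) :> K.
Proof.
eval_w; abstract_gens; intros.
(* Comparing factor by factor avoids having to show that the differences are nonzero. *)
by congr (_ * (_ / _) * (_ / _)); try (congr (_ - _)); field; nonzero.
Qed.

Definition T : K -> K := Xi \o (w \o w).

Lemma T_alg_hom : alg_hom T.
Proof.
exact: alg_hom_comp Xi_alg_hom (alg_hom_comp w_alg_hom w_alg_hom).
Qed.

Lemma TE x : T x = Xi (w (w x)).
Proof. by []. Qed.

Ltac eval_T :=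
  rewrite TE ?w_genE ?(alg_homE w_alg_hom) ?w_genE ?w_g
    ?(alg_homE Xi_alg_hom) ?XiE.

Lemma T_paramE :
  ((T nu1 = nu1 :> K) * (T nu2 = nu2 :> K) * (T nu3 = nu3 :> K) *
   (T nu4 = nu4 :> K) * (T nu5 = nu5 :> K) * (T nu6 = nu6 :> K) *
   (T nu7 = nu7 :> K) * (T nu8 = nu8 :> K) * (T kappa1 = (kappa1 / q)%R :> K) *
   (T kappa2 = (q * kappa2)%R :> K))%type.
Proof. by do !split; eval_T; field_gens. Qed.

(** Since [w f] is [1 / g], [T f] is the inverse of [Xi (w g)], which [w_g] makes explicit. *)
Lemma T_f :
  T f = nu3 * nu4 / f * (((g - nu5 / kappa2) * (g - nu6 / kappa2))
                         / ((g - 1 / nu1) * (g - 1 / nu2))).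
Proof.
have h5 : g * kappa2 - nu5 != 0 :> K by rewrite subr_eq0; apply: genM_neq.
have h6 : g * kappa2 - nu6 != 0 :> K by rewrite subr_eq0; apply: genM_neq.
have h1 : g * nu1 - 1 != 0 :> K by rewrite subr_eq0; apply: genM_neq1.
have h2 : g * nu2 - 1 != 0 :> K by rewrite subr_eq0; apply: genM_neq1.
eval_T.
(* Each of the four differences is a monomial times one factor of the stated right-hand side. *)
have -> : 1 / (g * kappa2 / (nu5 * nu6)) - nu1 * nu5 * nu6 / kappa2
    = - (nu1 * nu5 * nu6 / (kappa2 * g)) * (g - 1 / nu1) :> K by field_gens.
have -> : 1 / (g * kappa2 / (nu5 * nu6)) - nu2 * nu5 * nu6 / kappa2
    = - (nu2 * nu5 * nu6 / (kappa2 * g)) * (g - 1 / nu2) :> K by field_gens.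
have -> : 1 / (g * kappa2 / (nu5 * nu6))
      - nu1 * nu2 * nu5 * nu6 / kappa2 / (nu5 * nu1 * nu2 / kappa2)
    = - (nu6 / g) * (g - nu5 / kappa2) :> K by field_gens.
have -> : 1 / (g * kappa2 / (nu5 * nu6))
      - nu1 * nu2 * nu5 * nu6 / kappa2 / (nu6 * nu1 * nu2 / kappa2)
    = - (nu5 / g) * (g - nu6 / kappa2) :> K by field_gens.
move: h1 h2 h5 h6; abstract_gens; intros; field; nonzero.
Qed.

(** Applying [w] to the formula for [w g] turns [1 / g] into [1 / w g], whose image under [Xi] is
    [T f]; so [T g] becomes a rational expression in [T f], and the factor [f / kappa1] supplies the
    [1 / g]. *)
Lemma T_g :
  T g = 1 / (g * nu1 * nu2)
        * (((T f - T (kappa1 / nu7)) * (T f - T (kappa1 / nu8)))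
           / ((T f - nu3) * (T f - nu4))).
Proof.
have Tf : T f = 1 / Xi (w g).
  by rewrite TE w_genE !(alg_homE w_alg_hom) !(alg_homE Xi_alg_hom).
rewrite !(alg_homE T_alg_hom) !T_paramE Tf TE {1}w_g.
(* The remaining occurrences of [w g] stay opaque: they enter only through [1 / Xi a], which is
   [T f]. *)
rewrite !(alg_homE w_alg_hom) !w_genE; move: (w g) => a.
rewrite !(alg_homE Xi_alg_hom) !XiE.
move: (1 / Xi a); abstract_gens => F; intros.
rewrite -mulrA mulf_div; congr (_ * (_ / _)).
- by field; nonzero.
(* [Xi] swaps the roles of [nu7] and [nu8], and of [nu3] and [nu4], so the two factors come in the
   opposite order here and in the denominator. *)
- by rewrite mulrC; congr ((_ - _) * (_ - _)); field; nonzero.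
- by rewrite mulrC; congr ((_ - _) * (_ - _)); field; nonzero.
Qed.

(** * The inverse of [T] and the backward equation *)

Lemma s0K : cancel (@s0 R) s0.
Proof. by apply: subst_cancel; apply: s0_involution. Qed.

Lemma s1K : cancel (@s1 R) s1.
Proof. by apply: subst_cancel; apply: s1_involution. Qed.

Lemma s2K : cancel (@s2 R) s2.
Proof. by apply: subst_cancel; apply: s2_involution. Qed.

Lemma pi1K : cancel (@pi1 R) pi1.
Proof. by apply: subst_cancel; apply: pi1_involution. Qed.

Lemma pi2K : cancel (@pi2 R) pi2.
Proof. by apply: subst_cancel; apply: pi2_involution. Qed.

Definition w_inv : K -> K := s2 \o (s0 \o (s1 \o (s2 \o (pi1 \o pi2)))).
Definition T_inv : K -> K := w_inv \o w_inv \o subst (Xi_inv_tuple R).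

Lemma wK : cancel w w_inv.
Proof.
have c := can_comp (can_comp (can_comp pi2K pi1K) s2K) s1K.
exact: can_comp (can_comp c s0K) s2K.
Qed.

Lemma w_invK : cancel w_inv w.
Proof.
have c := can_comp s1K (can_comp s2K (can_comp pi1K pi2K)).
exact: can_comp s2K (can_comp s0K c).
Qed.

Lemma TK : cancel T T_inv.
Proof.
apply: can_comp; last by apply: can_comp wK wK.
exact: subst_cancel (@Xi_inverse R) (@Xi_inv_inverse R).
Qed.

Lemma T_invK : cancel T_inv T.
Proof.
apply: can_comp; first by apply: can_comp w_invK w_invK.
exact: subst_cancel (@Xi_inv_inverse R) (@Xi_inverse R).
Qed.

(** With [h] the right-hand side, [T_g] says that [T g] is [T h / g]. Hence [T] sends [h / g] to
    [g], and [T_inv g] must be [h / g]. *)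
Lemma T_inv_g :
  g * T_inv g = 1 / (nu1 * nu2) * (((f - kappa1 / nu7) * (f - kappa1 / nu8))
                                 / ((f - nu3) * (f - nu4))).
Proof.
set h := RHS.
have Tg0 : T g != 0 by apply: (alg_hom_neq0 T_alg_hom); apply: gen_neq0.
have Th : T (h / g) = g.
  move: Tg0; rewrite /h !(alg_homE T_alg_hom) T_g !(alg_homE T_alg_hom).
  rewrite !T_paramE.
  set X := (_ * _ / _) => Tg0.
  (* [T g] is a multiple of the quotient [X], so [X] is nonzero as a whole and its differences need
     no separate treatment. *)
  have : X != 0 by apply: contra_neq Tg0 => ->; apply: mulr0.
  by move: X {h Tg0}; abstract_gens; intros; field; nonzero.
have Ug : T_inv g = h / g by rewrite -[in LHS]Th TK.
have mulKdiv (F : fieldType) (a b : F) : b != 0 -> b * (a / b) = a.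
  by move=> b0; rewrite mulrC divfK.
by rewrite Ug; apply: mulKdiv; apply: gen_neq0.
Qed.

(** * [Xi] as a rescaling of the ten quantities *)

Lemma Xi_ten i :
  Xi (tnth (@ten R) i)
  = tnth (G (kappa2 / (nu5 * nu6)) (D (kappa1 / (q * nu3 * nu4)) ten)) i.
Proof.
rewrite !(tnth_nth 0); case: i => i lt_i.
do 10!(case: i lt_i => [|i] lt_i; first by
  rewrite /= ?(alg_homE Xi_alg_hom) !XiE;
  (* The equation is restated over [K], the form of the carrier that [abstract_gens] generalizes. *)
  match goal with |- ?x = ?y => change (@eq K x y) end; field_gens).
by [].
Qed.

(** Both sides evaluate the same numerator and denominator of [Z], and a homomorphism fixing the
    constants commutes with polynomial evaluation; this leaves only the ten values in [Xi_ten]. *)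
Lemma Xi_subst_ten (Z : ratfun R 10) :
  Xi (subst ten Z)
  = subst (G (kappa2 / (nu5 * nu6)) (D (kappa1 / (q * nu3 * nu4)) ten)) Z.
Proof.
have Xi_mmap p : Xi (mmap (@cst R) (tnth ten) p) = mmap (@cst R)
    (tnth (G (kappa2 / (nu5 * nu6)) (D (kappa1 / (q * nu3 * nu4)) ten))) p.
  have [_ _ Tc] := Xi_alg_hom.
  rewrite [LHS](rmorph_mmap (T := alg_hom_rmorph Xi_alg_hom) _ _ Tc).
  apply: eq_bigr => m _; congr (_ * _); apply: mmap1_eq => i.
  exact: Xi_ten.
by rewrite /subst (alg_homM Xi_alg_hom) (alg_homV Xi_alg_hom) !Xi_mmap.
Qed.
End Evolution.

Theorem theorem2p1 (R : realType) :
  let w : K R -> K R := pi2 \o pi1 \o s2 \o s1 \o s0 \o s2 in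
  let T : K R -> K R := Xi \o (w \o w) in
  (T f = nu3 * nu4 / f * (((g - nu5 / kappa2) * (g - nu6 / kappa2))
                          / ((g - 1 / nu1) * (g - 1 / nu2))) /\
   T g = 1 / (g * nu1 * nu2)
         * (((T f - T (kappa1 / nu7)) * (T f - T (kappa1 / nu8)))
            / ((T f - nu3) * (T f - nu4))) /\
   ([/\ T nu1 = nu1, T nu2 = nu2, T nu3 = nu3 & T nu4 = nu4] /\
    [/\ T nu5 = nu5, T nu6 = nu6, T nu7 = nu7 & T nu8 = nu8]) /\
   T kappa1 = kappa1 / q /\
   T kappa2 = q * kappa2 /\
   qPD5_time_evolution T) /\
  (forall Z : ratfun R 10,
     Xi (subst ten Z)
     = subst (G (kappa2 / (nu5 * nu6)) (D (kappa1 / (q * nu3 * nu4)) ten)) Z).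
Proof.
move=> w' T'; change T' with (@T R); clear T' w'.
have Tp := T_paramE R.
split; last exact: Xi_subst_ten.
split; first exact: T_f.
split; first exact: T_g.
split; first by rewrite !Tp.
do 2!(split; first by rewrite Tp).
split; first exact: T_alg_hom.
exists (@T_inv R); split; first by split; [exact: TK|exact: T_invK].
split; first by rewrite T_f mulrA [f * _]mulrC divfK //; apply: gen_neq0.
split; first exact: T_inv_g.
by rewrite !Tp.
Qed.
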